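(* Let $X$ be a nonempty set, let $n\geq 2$ be an integer and let $F\colon X^n\to X$ be an $n$-ary operation. Then $(X,F)$ is a symmetric $n$-ary band if and only if it is a strong $n$-ary semilattice of $n$-ary extensions of Abelian groups whose exponents divide $n-1$; that is, if and only if $(X,F)$ is a strong $n$-ary semilattice $(Y,\wedge^{n-1})$ of $n$-ary semigroups $(X_\alpha,F_\alpha)$ ($\alpha\in Y$) in which each $(X_\alpha,F_\alpha)$ is the $n$-ary extension of an Abelian group whose exponent divides $n-1$.
   Context: An $n$-ary groupoid is a pair $(X,F)$ with $X$ a nonempty set and $F\colon X^n\to X$. The operation $F$ is associative if $F(x_1,\ldots,x_{i-1},F(x_i,\ldots,x_{i+n-1}),x_{i+n},\ldots,x_{2n-1})=F(x_1,\ldots,x_i,F(x_{i+1},\ldots,x_{i+n}),x_{i+n+1},\ldots,x_{2n-1})$ for all $x_1,\ldots,x_{2n-1}\in X$ and all $1\le i\le n-1$; then $(X,F)$ is an $n$-ary semigroup. $F$ is idempotent if $F(x,\ldots,x)=x$ for all $x\in X$, and symmetric if it is invariant under all permutations of its arguments. A symmetric $n$-ary band is an $n$-ary semigroup $(X,F)$ with $F$ symmetric and idempotent. A homomorphism $(X,F)\to(X',F')$ of $n$-ary groupoids is a map $\varphi\colon X\to X'$ with $\varphi(F(x_1,\ldots,x_n))=F'(\varphi(x_1),\ldots,\varphi(x_n))$ for all $x_1,\dots,x_n\in X$. The $n$-ary extension of a semigroup $(X,\ast)$ is $(X,F)$ with $F(x_1,\ldots,x_n)=x_1\ast\cdots\ast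 x_n$; for a semilattice $(Y,\wedge)$ the $n$-ary extension of $\wedge$ is denoted $\wedge^{n-1}$. A semilattice is a commutative idempotent semigroup, ordered by $\alpha\geq\beta \iff \alpha\wedge\beta=\beta$. The exponent of a group divides $n-1$ means that every element $x$ satisfies $x^{n-1}=e$, with $e$ the neutral element. An $n$-ary groupoid $(X,F)$ is an $n$-ary semilattice $(Y,\wedge^{n-1})$ of $n$-ary semigroups $(X_\alpha,F_\alpha)$ if $(Y,\wedge)$ is a semilattice, $X$ is the disjoint union of nonempty subsets $X_\alpha$, $\alpha\in Y$, one has $F(X_{\alpha_1}\times\cdots\times X_{\alpha_n})\subseteq X_{\alpha_1\wedge\cdots\wedge\alpha_n}$ for all $\alpha_1,\ldots,\alpha_n\in Y$, and for each $\alpha\in Y$ the restriction $F_\alpha$ of $F$ to $X_\alpha^n$ is an $n$-ary semigroup operation on $X_\alpha$. It is a strong $n$-ary semilattice of the $n$-ary semigroups $(X_\alpha,F_\alpha)$ if moreover for all $\alpha\geq\beta$ in $Y$ there is a homomorphism $\varphi_{\alpha,\beta}\colon (X_\alpha,F_\alpha)\to (X_\beta,F_\beta)$ such that: (a) $\varphi_{\alpha,\alpha}$ is the identity on $X_\alpha$; (b) $\varphi_{\beta,\gamma}\circ\varphi_{\alpha,\beta}=\varphi_{\alpha,\gamma}$ whenever $\alpha\geq\beta\geq\gamma$; (c) for all $(x_1,\ldots,x_n)\in X_{\alpha_1}\times\cdots\times X_{\alpha_n}$, setting $\alpha=\alpha_1\wedge\cdots\wedge\alpha_n$, $F(x_1,\ldots,x_n)=F_\alpha(\varphi_{\alpha_1,\alpha}(x_1),\ldots,\varphi_{\alpha_n,\alpha}(x_n))$.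 *)

(* Defs.v *)
From HB Require Import structures.
From mathcomp Require Import all_boot all_order all_fingroup all_algebra.
From mathcomp Require Import classical_sets.

Set Implicit Arguments.
Unset Strict Implicit.
Unset Printing Implicit Defensive.

Import Order.TTheory GRing.Theory.
Local Open Scope classical_set_scope.

Definition nary_op (n : nat) (X : Type) := n.-tuple X -> X.

Section NaryGroupoids.
Variables (n : nat) (X : Type).
Implicit Type F : nary_op n X.

(* Indices are 0-based: [insert_at F i x] is the tuple
   (x 0, ..., x (i-1), F (x i, ..., x (i+n-1)), x (i+n), ..., x (2n-2)).
   Only the values x 0, ..., x (2n-2) of x are used. *)
Definition insert_at F (i : nat) (x : nat -> X) : n.-tuple X :=
  [tuple if j < i then x j
         else if j == i :> nat then F [tuple x (i + k) | k < n]
         else x (j + n.-1) | j < n].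

Definition nary_associative F :=
  forall (x : nat -> X) (i : nat), i.+1 < n ->
    F (insert_at F i x) = F (insert_at F i.+1 x).

Definition nary_idempotent F := forall x : X, F [tuple x | _ < n] = x.

Definition nary_symmetric F :=
  forall (s : 'S_n) (t : n.-tuple X), F [tuple tnth t (s i) | i < n] = F t.

Definition symmetric_nary_band F :=
  [/\ nary_associative F, nary_symmetric F & nary_idempotent F].

(* The product t_0 * ... * t_(n-1), bracketed to the left; n_gt0 provides the
   first factor, since the semigroup need not have a neutral element. *)
Definition nary_ext (n_gt0 : 0 < n) (op : X -> X -> X) : nary_op n X :=
  fun t => foldl op (tnth t (Ordinal n_gt0)) (behead t).

(* The group has carrier X itself: cG is a zmodType structure on X. *)
Definition is_abelian_group_ext (n_gt0 : 0 < n) F :=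
  exists cG : GRing.Zmodule X,
    let G : zmodType := GRing.Zmodule.Pack cG in
    F =1 nary_ext n_gt0 (@GRing.add G) /\
    (forall x : G, x *+ n.-1 = 0)%R.

End NaryGroupoids.

Definition nary_hom (n : nat) (X X' : Type) (F : nary_op n X)
    (F' : nary_op n X') (phi : X -> X') :=
  forall t : n.-tuple X, phi (F t) = F' [tuple phi (tnth t i) | i < n].

Section NaryMeet.
Variables (d : Order.disp_t) (Y : meetSemilatticeType d).
Variables (n : nat) (n_gt0 : 0 < n).

Definition nary_meet : nary_op n Y := nary_ext n_gt0 Order.meet.

Lemma foldl_meet_le (y : Y) (s : seq Y) :
  (foldl Order.meet y s <= y)%O /\
  (forall i, i < size s -> (foldl Order.meet y s <= nth y s i)%O).
Proof.
elim: s y => [|z s IHs] y /=; first by split.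
have [le1 le2] := IHs (Order.meet y z); split.
  exact: le_trans le1 (leIl _ _).
case=> [_|i lt_i] /=; first exact: le_trans le1 (leIr _ _).
by rewrite (set_nth_default (Order.meet y z)) // le2.
Qed.

Lemma nary_meet_le (a : n.-tuple Y) (i : 'I_n) : (nary_meet a <= tnth a i)%O.
Proof.
rewrite /nary_meet /nary_ext.
case: n n_gt0 a i => [//|m] m_gt0 a i.
have -> : Ordinal m_gt0 = ord0 by apply: val_inj.
have [le1 le2] := foldl_meet_le (tnth a ord0) (behead a).
case: (unliftP ord0 i) => [j|] ->; last exact: le1.
rewrite [tnth a (lift ord0 j)](tnth_nth (tnth a ord0)) -[nth _ a _]nth_behead.
by apply: le2; rewrite size_behead size_tuple.
Qed.

End NaryMeet.

Section NarySemilattices.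
Variables (n : nat) (n_gt0 : 0 < n) (X : Type) (F : nary_op n X).
Variables (d : Order.disp_t) (Y : meetSemilatticeType d).
Variables (X_ : Y -> set X) (F_ : forall a : Y, nary_op n (X_ a)).

Record nary_semilattice_of : Prop := NarySemilatticeOf {
  component_nonempty : forall a : Y, X_ a !=set0;
  component_cover : \bigcup_a X_ a = [set: X];
  component_disjoint : trivIset [set: Y] X_;
  component_meet : forall (a : n.-tuple Y) (x : n.-tuple X),
    (forall i : 'I_n, X_ (tnth a i) (tnth x i)) ->
    X_ (nary_meet n_gt0 a) (F x);
  component_restr : forall (a : Y) (t : n.-tuple (X_ a)),
    val (F_ t) = F [tuple val (tnth t i) | i < n];
  component_assoc : forall a : Y, nary_associative (@F_ a)
}.

Record strong_system (phi : forall a b : Y, (b <= a)%O -> X_ a -> X_ b) :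
    Prop := StrongSystem {
  strong_hom : forall (a b : Y) (le_ba : (b <= a)%O),
    nary_hom (@F_ a) (@F_ b) (phi a b le_ba);
  strong_id : forall a : Y, phi a a (lexx a) =1 id;
  strong_comp : forall (a b c : Y) (le_ba : (b <= a)%O) (le_cb : (c <= b)%O),
    phi b c le_cb \o phi a b le_ba =1 phi a c (le_trans le_cb le_ba);
  strong_op : forall (a : n.-tuple Y) (x : forall i : 'I_n, X_ (tnth a i)),
    F [tuple val (x i) | i < n] =
    val (F_ [tuple phi _ _ (nary_meet_le n_gt0 a i) (x i) | i < n])
}.

Definition strong_nary_semilattice_of : Prop :=
  nary_semilattice_of /\ exists phi, strong_system phi.

End NarySemilattices.

(* Main.v *)
Require Import Defs.
From HB Require Import structures.
From mathcomp Require Import all_boot all_order all_fingroup all_algebra.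
From mathcomp Require Import classical_sets boolp zify.

Set Implicit Arguments.
Unset Strict Implicit.
Unset Printing Implicit Defensive.

(** Let F be a symmetric n-ary band.  Associativity and symmetry together make
    every product of 1 + k (n - 1) factors independent of the bracketing and of
    the order of the factors ([mprod_perm]), so an identity between iterated
    values of F only needs both sides to have the same factors with the same
    multiplicities.  Consider the binary operation z . y = F (z, y, ..., y)
    ([star]).  Comparing factors, and shrinking y ... y (n times) to y by
    idempotency, one finds that . is a left normal band,
      z . z = z,   z . (y . w) = (z . y) . w,   z . y . w = z . w . y,
    that each right translation z |-> z . y is an endomorphism of F
    ([star_op]), and that z . F (x_1, ..., x_n) = z . x_1 . ... . x_n
    ([star_opr]).  In other words, . is a partition function of F in the sense
    of Plonka.  The right translations therefore form a semilattice Y under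
    composition.  Send x to the class of its translation: the fibers of this map
    are the components, and acting on the fiber over a by a translation b <= a
    gives the structural homomorphism from a to b.  The strong law holds
    because F (x_1, ..., x_n) lies in the fiber over the meet c of the classes,
    hence is fixed by the translation c, which distributes over F.

    Within one fiber all translations coincide, so F (x, y, ..., y) = x there.
    Fixing an element e, the operation x + y = F (x, y, e, ..., e) is an Abelian
    group law with neutral element e and inverse F (e, e, x, ..., x); its n-ary
    extension is F, and x added n - 1 times to e gives F (e, x, ..., x) = e
    ([neutral_band_group]).

    Conversely, in a strong semilattice of such groups an element x is
    determined by its class and its images in all components below
    ([eq_proj]).  The class of F (x_1, ..., x_n) is the meet of the classes, and
    its image in a component below is the value of F there on the images of the
    x_i ([proj_op]).  Each band law for F thus splits into the same law for
    meets, which holds because a meet depends only on the set of its arguments,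
    and the same law for the components, where symmetry and idempotency come
    from commutativity and from the bound on the exponent. *)

(** * Functions of sequences invariant under adjacent swaps *)

Section AdjacentSwaps.
Variables (T : eqType) (R : Type) (N : nat) (g : seq T -> R).
Hypothesis g_swap : forall p a b q, size (p ++ a :: b :: q) = N ->
  g (p ++ a :: b :: q) = g (p ++ b :: a :: q).

Lemma swap_move p a q r : size (p ++ a :: q ++ r) = N ->
  g (p ++ a :: q ++ r) = g (p ++ q ++ a :: r).
Proof.
elim: q p => [|b q IHq] p //= szN.
rewrite g_swap // -cat_rcons IHq ?cat_rcons //.
by rewrite -szN !size_cat /= !addnS.
Qed.

(** The length restriction is what makes this usable for products of a fixed
    number of factors, which exist for some lengths only. *)
Lemma swap_perm s t : size s = N -> perm_eq s t -> g s = g t.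
Proof.
suffices swap_suffix p :
    size (p ++ s) = N -> perm_eq s t -> g (p ++ s) = g (p ++ t).
  exact: (swap_suffix [::]).
elim: s t p => [|a s IHs] t p szN st.
  by move/perm_size/esym/size0nil: st => ->.
have a_t: a \in t by rewrite -(perm_mem st) mem_head.
case/splitPr: a_t st => t1 t2 st.
have {}st : perm_eq s (t1 ++ t2).
  by rewrite -(perm_cons a) (permPl st) -cat1s perm_catCA.
have sz_st := perm_size st; rewrite size_cat in sz_st.
move: szN; rewrite size_cat /= => szN.
rewrite -cat_rcons (IHs _ _ _ st) ?cat_rcons ?swap_move //;
  rewrite !size_cat ?size_rcons /= ?size_cat; lia.
Qed.
End AdjacentSwaps.

(** * Iterated products under a symmetric associative operation *)

Section MultiProduct.
Variables (X : eqType) (x0 : X) (m : nat) (F : nary_op m.+2 X).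
Hypotheses (F_assoc : nary_associative F) (F_sym : nary_symmetric F).

(** The default [x0] only makes the function total: all uses are on sequences of
    length [m.+2], so that associativity and symmetry can be read on lists. *)
Definition seq_op (s : seq X) : X := F [tuple nth x0 s i | i < m.+2].
Notation f := seq_op.

Lemma seq_opE (t : m.+2.-tuple X) : f t = F t.
Proof. by congr F; apply: eq_from_tnth => i; rewrite tnth_mktuple -tnth_nth. Qed.

Lemma seq_op_perm s t : size s = m.+2 -> perm_eq s t -> f s = f t.
Proof.
move=> /eqP szs st; have szt : size t == m.+2 by rewrite -(perm_size st).
have -> : s = Tuple szs by []. have -> : t = Tuple szt by [].
have /tuple_permP[p ->] : perm_eq (Tuple szs) (Tuple szt) by [].
by rewrite !seq_opE F_sym.
Qed.

Lemma seq_op_assoc a s b t : size s = m.+1 -> size t = m ->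
  f (f (a :: s) :: b :: t) = f (a :: f (rcons s b) :: t).
Proof.
move=> szs szt; pose x := nth x0 (a :: s ++ b :: t).
have := @F_assoc x 0 isT; congr (_ = _); congr F; apply: eq_from_tnth => i;
  rewrite !tnth_mktuple.
- case: i => -[|i] /= lt_i; first congr F.
    apply: eq_from_tnth => j; rewrite !tnth_mktuple /x add0n -cat_cons nth_cat.
    by rewrite /= szs ltn_ord.
  by rewrite /x addSn /= nth_cat szs ltnNge leq_addl /= addnK.
- case: i => -[|[|i]] //= lt_i; first congr F.
    apply: eq_from_tnth => j; rewrite !tnth_mktuple /x add1n /=.
    by rewrite -cat_rcons nth_cat size_rcons szs ltn_ord.
  rewrite /x addSn /= -cat_rcons addSnnS nth_cat size_rcons szs.
  by rewrite ltnNge leq_addl /= addnK.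
Qed.

(** The product of a sequence of [1 + k * m.+1] factors, bracketed to the left:
    each round replaces the first [m.+2] factors by their product. *)
Fixpoint mprod k s : X :=
  if k is k'.+1 then mprod k' (f (take m.+2 s) :: drop m.+2 s) else head x0 s.

Lemma mprodS k s t : size s = m.+2 -> mprod k.+1 (s ++ t) = mprod k (f s :: t).
Proof. by move=> szs /=; rewrite take_size_cat ?drop_size_cat. Qed.

Arguments mprod : simpl never.

Lemma mprod1 s : size s = m.+2 -> mprod 1 s = f s.
Proof. by move=> szs; rewrite -[s in LHS]cats0 mprodS. Qed.

(** The only swap which neither symmetry nor the induction hypothesis gives is
    the one of the last factor of the first block with the first factor after
    it; associativity, in the form of [seq_op_assoc], brings both into one
    block. *)
Lemma mprod_swap k p a b q : size (p ++ a :: b :: q) = (k * m.+1).+1 ->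
  mprod k (p ++ a :: b :: q) = mprod k (p ++ b :: a :: q).
Proof.
elim: k p => [|k IHk] p szN; first by move: szN; rewrite size_cat /=; lia.
have [le_p|lt_p] := leqP m.+2 (size p).
  rewrite -[p](cat_take_drop m.+2) -!catA !mprodS ?size_take_min ?(minn_idPl le_p) //.
  rewrite -!cat_cons IHk //; move: szN; rewrite !size_cat /= size_drop; lia.
have [eq_p|ne_p] := eqVneq (size p) m.+1.
  case: k szN {IHk} => [|k] szN; first by move: szN; rewrite size_cat /=; lia.
  rewrite -(cat_rcons a) -(cat_rcons b p) !(mprodS k.+1) ?size_rcons ?eq_p //.
  have szq : m <= size q by move: szN; rewrite size_cat /=; lia.
  have sztake : size (take m q) = m by rewrite size_take_min (minn_idPl szq).
  rewrite -(cat_take_drop m q) -!cat_cons !mprodS /= ?sztake //.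
  congr (mprod k (_ :: _)).
  case: p eq_p {szN lt_p} => [//|c p] [szp] /=.
  rewrite !seq_op_assoc ?size_rcons ?szp //.
  congr (f (_ :: _ :: _)); apply: seq_op_perm; first by rewrite !size_rcons szp.
  by rewrite -!cats1 -!catA perm_cat2l (perm_catC [:: a]).
have {}lt_p : size p <= m by lia.
pose r := take (m - size p) q.
have szr : size r = m - size p.
  by rewrite size_take_min; apply/minn_idPl; move: szN; rewrite size_cat /=; lia.
rewrite -(cat_take_drop (m - size p) q) -/r.
have catE c d u v : p ++ c :: d :: u ++ v = (p ++ c :: d :: u) ++ v :> seq X.
  by rewrite -catA.
rewrite !catE !mprodS ?size_cat /= ?szr; try lia.
congr (mprod k (_ :: _)); apply: seq_op_perm; first by rewrite size_cat /= szr; lia.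
by rewrite perm_cat2l; apply: permEl (perm_catCA [:: a] [:: b] r).
Qed.

Lemma mprod_perm k s t :
  size s = (k * m.+1).+1 -> perm_eq s t -> mprod k s = mprod k t.
Proof. by apply: swap_perm; apply: mprod_swap. Qed.

(** A block can be multiplied out anywhere in the product, since permuting the
    factors brings it to the front. *)
Lemma mprod_flatten k rows t :
    all (fun r => size r == m.+2) rows -> size rows + size t = (k * m.+1).+1 ->
  mprod (k + size rows) (flatten rows ++ t) = mprod k (map f rows ++ t).
Proof.
elim: rows k t => [|r rows IHr] k t /=; first by rewrite addn0.
case/andP=> /eqP szr szrows szt.
rewrite addnS -catA mprodS //.
have szfl : size (flatten rows) = (size rows * m.+2)%N.
  rewrite size_flatten /shape; elim: {+}rows szrows => //= r' rs IH /andP[/eqP-> /IH->].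
  by rewrite mulSn.
rewrite (@mprod_perm _ _ (flatten rows ++ f r :: t)) /=; first last.
- by rewrite -[f r :: t]cat1s -cat1s perm_catCA.
- by rewrite size_cat szfl /=; lia.
rewrite IHr //=; try lia.
apply: mprod_perm; first by rewrite size_cat /= size_map; lia.
by rewrite -[f r :: t]cat1s -[f r :: _]cat1s perm_catCA.
Qed.
End MultiProduct.
Arguments mprod {X} x0 {m} F k s : simpl never.

(** * The left normal band of a symmetric n-ary band *)

Section LeftNormalBand.
Variables (X : eqType) (x0 : X) (m : nat) (F : nary_op m.+2 X).
Hypothesis F_band : symmetric_nary_band F.

Let F_assoc : nary_associative F. Proof. by case: F_band. Qed.
Let F_sym : nary_symmetric F. Proof. by case: F_band. Qed.
Notation f := (seq_op x0 F).
Notation mprod := (mprod x0 F).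

Lemma seq_op_nseq x : f (nseq m.+2 x) = x.
Proof.
have [_ _ F_idem] := F_band; rewrite -[RHS]F_idem; congr F.
by apply: eq_from_tnth => i; rewrite !tnth_mktuple nth_nseq ltn_ord.
Qed.

(** In the decomposition to be constructed, [star z y] is the image of [z] in the
    component of the meet of the classes of [z] and [y]. *)
Definition star z y := f (z :: nseq m.+1 y).

Lemma starxx x : star x x = x. Proof. exact: seq_op_nseq. Qed.

(** Iterated translations are a single product, whose factors besides [z] are
    [m.+1] copies of each term of [s]; the laws of [star] are read off from it. *)
Lemma foldl_star z s :
  foldl star z s = mprod (size s) (z :: flatten (map (nseq m.+1) s)).
Proof.
elim: s z => [//|y s IHs] z; rewrite [LHS]IHs.
by rewrite -(mprodS x0 F) /= ?size_nseq.
Qed.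

Lemma size_flatten_nseq (s : seq X) :
  size (flatten (map (nseq m.+1) s)) = size s * m.+1.
Proof. by elim: s => //= y s IHs; rewrite size_cat size_nseq IHs. Qed.

Lemma foldl_star_perm z s t : perm_eq s t -> foldl star z s = foldl star z t.
Proof.
move=> st; rewrite !foldl_star -(perm_size st).
apply: mprod_perm => //; first by rewrite /= size_flatten_nseq.
by rewrite perm_cons; apply/perm_flatten/perm_map.
Qed.

Lemma starAC z y w : star (star z y) w = star (star z w) y.
Proof.
apply: (@foldl_star_perm z [:: y; w] [:: w; y]).
exact: permEl (perm_catC [:: y] [:: w]).
Qed.

(** Among the [m.+1 + m.+1] factors [y], a group of [m.+2] is absorbed into a
    single one by idempotency. *)
Lemma starK z y : star (star z y) y = star z y.
Proof.
rewrite -[LHS]/(foldl star z [:: y; y]) foldl_star.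
rewrite (@mprod_perm _ _ _ _ _ _ _ _ (nseq m.+2 y ++ z :: nseq m y)) //; first last.
- apply/seq.permP => a; rewrite /= cats0 !count_cat /= !count_nseq.
  by case: (a y); lia.
- by congr _.+1; apply: (size_flatten_nseq [:: y; y]).
rewrite mprodS ?size_nseq // mprod1 /= ?size_nseq // -/(nseq m.+2 y) seq_op_nseq.
apply: seq_op_perm; rewrite //= ?size_nseq //.
exact: permEl (perm_catCA [:: y] [:: z] _).
Qed.

Lemma foldl_starK z y k : foldl star z (nseq k.+1 y) = star z y.
Proof. by elim: k => //= k IHk; rewrite -[RHS]IHk /= starK. Qed.

(** The right-hand side has the factors of [f s] and [m.+1] copies of [y] for each
    of the [m.+2] arguments; this is [m.+2] successive translations of [f s] by
    [y], and repeating a translation changes nothing. *)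
Lemma star_op s y : size s = m.+2 -> star (f s) y = f (map (star^~ y) s).
Proof.
move=> szs; rewrite -(foldl_starK (f s) y m.+1) foldl_star size_nseq.
rewrite -(mprodS x0 F) // -(mprod1 x0 F) ?size_map // -[map _ s]cats0.
rewrite (map_comp f (fun a => a :: nseq m.+1 y)).
rewrite -(mprod_flatten x0) ?size_map ?szs ?mul1n ?addn0 //; last first.
- by rewrite all_map; apply/allP => a _ /=; rewrite size_nseq.
apply: mprod_perm => //.
  by rewrite size_cat size_flatten_nseq size_nseq szs; lia.
rewrite cats0 -{}szs; elim: s => //= a s IHs.
rewrite perm_cons -[y :: nseq m y ++ _]/(nseq m.+1 y ++ _).
rewrite -[y :: nseq m y ++ flatten _]/(nseq m.+1 y ++ _).
by rewrite perm_catCA perm_cat2l.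
Qed.

Lemma perm_flatten_nseq (s : seq X) k :
  perm_eq (flatten (nseq k s)) (flatten (map (nseq k) s)).
Proof.
apply/seq.permP => a; rewrite count_flatten map_nseq sumn_nseq.
elim: s => [|y s IHs] /=; first by rewrite mul0n.
by rewrite count_cat -IHs count_nseq mulnDl.
Qed.

(** Both sides have the factor [z] and [m.+1] copies of each term of [s], grouped
    as copies of [s] on one side and term by term on the other. *)
Lemma star_opr z s : size s = m.+2 -> star z (f s) = foldl star z s.
Proof.
move=> szs; rewrite foldl_star szs /star.
rewrite (@seq_op_perm _ x0 _ _ F_sym _ (map f (nseq m.+1 s) ++ [:: z])) //; first last.
- by rewrite map_nseq -[z :: _]cat1s perm_catC.
- by rewrite /= size_nseq.
rewrite -(mprod1 x0) ?size_cat ?size_map ?size_nseq ?addn1 //.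
rewrite -(mprod_flatten x0) ?size_nseq ?addn1 ?mul1n //; last first.
- by apply/allP => r /nseqP[-> _]; rewrite szs.
rewrite add1n; apply: mprod_perm => //.
  rewrite size_cat (perm_size (perm_flatten_nseq _ _)) size_flatten_nseq szs /=; lia.
by rewrite cats1 perm_rcons perm_cons perm_flatten_nseq.
Qed.

Lemma starA z y w : star z (star y w) = star (star z y) w.
Proof.
rewrite -(foldl_starK (star z y) w m).
by apply: (@star_opr z (y :: nseq m.+1 w)); rewrite /= size_nseq.
Qed.
End LeftNormalBand.

(** * Bands with trivial translations are groups *)

Lemma zmodType_of_group_laws (T : Type) (zero : T) (opp : T -> T)
    (add : T -> T -> T) : associative add -> commutative add ->
    left_id zero add -> left_inverse zero opp add ->
  exists cG : GRing.Zmodule T, @GRing.add (GRing.Zmodule.Pack cG) = add.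
Proof.
move=> addA addC add0 addN.
pose C : choiceType := HB.pack T (gen_eqMixin T) (gen_choiceMixin T).
pose G : zmodType := HB.pack T (Choice.on C)
  (GRing.isZmodule.Build C addA addC add0 addN).
by exists (GRing.Zmodule.class G).
Qed.

Section NeutralBand.
Variables (X : eqType) (e : X) (m : nat) (F : nary_op m.+2 X).
Hypotheses (F_band : symmetric_nary_band F).
Hypothesis starE : forall x y, star e F x y = x.

Let F_assoc : nary_associative F. Proof. by case: F_band. Qed.
Let F_sym : nary_symmetric F. Proof. by case: F_band. Qed.
Notation f := (seq_op e F).
Notation mprod := (mprod e F).

Definition band_add x y := f (x :: y :: nseq m e).
(** In a group whose exponent divides [m.+1], the inverse of [x] is [x *+ m];
    this is that multiple, expressed through F. *)
Definition band_opp x := f (e :: e :: nseq m x).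

Lemma band_addC : commutative band_add.
Proof.
move=> x y; apply: seq_op_perm => //=; first by rewrite size_nseq.
exact: permEl (perm_catCA [:: x] [:: y] _).
Qed.

Lemma op_cat_mprod s t : size s = m.+2 -> size t = m.+1 ->
  f (f s :: t) = mprod 2 (s ++ t).
Proof. by move=> szs szt; rewrite mprodS // mprod1 //= szt. Qed.

Lemma band_addA : associative band_add.
Proof.
move=> x y z; rewrite band_addC /band_add !op_cat_mprod /= ?size_nseq //.
apply: (mprod_perm e F_assoc F_sym (k := 2)) => //.
  by rewrite /= size_cat /= !size_nseq; lia.
apply/seq.permP => a; rewrite /= !count_cat /=; lia.
Qed.

Lemma band_add0 : left_id e band_add.
Proof. by move=> x; rewrite band_addC [LHS]starE. Qed.

(** The factors of [band_opp x + x] are [e, x, ..., x] and [m.+1] copies of [e],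
    which is the product [star (star e x) e]. *)
Lemma band_addN : left_inverse e band_opp band_add.
Proof.
move=> x; rewrite -[RHS](starE e x) -[RHS](starE _ e).
rewrite /star /band_add !op_cat_mprod /= ?size_nseq //.
apply: (mprod_perm e F_assoc F_sym (k := 2)) => //.
  by rewrite /= size_cat /= !size_nseq; lia.
apply/seq.permP => a; rewrite /= !count_cat /= !count_nseq; lia.
Qed.

Lemma foldl_band_add x s :
  foldl band_add x s = mprod (size s) (x :: s ++ nseq (size s * m) e).
Proof.
elim: s x => [//|y s IHs] x; rewrite [LHS]IHs /band_add -mprodS /= ?size_nseq //.
apply: (mprod_perm e F_assoc F_sym (k := (size s).+1)) => //.
  by rewrite /= !size_cat !size_nseq; lia.
apply/seq.permP => a; rewrite /= !count_cat !count_nseq; case: (a e); lia.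
Qed.

Lemma flatten_nseq_nseq (T : Type) (x : T) a b :
  flatten (map (nseq a) (nseq b x)) = nseq (b * a) x.
Proof. by elim: b => //= b ->; rewrite mulSn nseqD. Qed.

(** Adding up the arguments of F one by one contributes [m.+1 * m] factors [e]
    besides the arguments; regrouped by [m.+1], they are [m] trivial
    translations by [e]. *)
Lemma nary_ext_band_add n_gt0 : F =1 nary_ext n_gt0 band_add.
Proof.
move=> t; rewrite /nary_ext foldl_band_add size_behead size_tuple -cat_cons.
have -> : tnth t (Ordinal n_gt0) :: behead t = t.
  by case: t => -[|y s] i //=; rewrite (tnth_nth y).
rewrite mprodS ?size_tuple // mulnC -flatten_nseq_nseq.
have := foldl_star e F (f t) (nseq m e); rewrite size_nseq /= => <-.
have foldlE y s : foldl (star e F) y s = y.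
  by elim: s y => //= z s IHs y; rewrite starE.
by rewrite foldlE seq_opE.
Qed.

Lemma neutral_band_group n_gt0 : is_abelian_group_ext n_gt0 F.
Proof.
have [cG addE] := zmodType_of_group_laws band_addA band_addC band_add0 band_addN.
exists cG => G; split; first by rewrite addE; apply: nary_ext_band_add.
have foldlE (x y : G) k : foldl (@GRing.add G) y (nseq k x) = (y + x *+ k)%R.
  elim: k y => [|k IHk] y /=; first by rewrite GRing.mulr0n GRing.addr0.
  by rewrite IHk GRing.mulrS GRing.addrA.
move=> x; have := nary_ext_band_add n_gt0 [tuple of e :: nseq m.+1 x].
rewrite -(seq_opE e) [LHS]starE /nary_ext [tnth _ _]/= -addE [RHS](foldlE x e).
by move=> e_eq; apply: (@GRing.addrI G e); rewrite GRing.addr0 -e_eq.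
Qed.
End NeutralBand.

(** * The semilattice of right translations *)

Import Order.TTheory.

(** The right translations are closed under composition, since
    [z . (y . w) = (z . y) . w], and they are commuting idempotents, so that
    composition is a meet.  Elements are classified by their translation, and
    [rep] selects an element in each class. *)
Lemma left_normal_band_semilattice (X : Type) (star : X -> X -> X) :
    (forall x, star x x = x) ->
    (forall z y w, star z (star y w) = star (star z y) w) ->
    (forall z y w, star (star z y) w = star (star z w) y) ->
  exists (d : Order.disp_t) (Y : meetSemilatticeType d) (cls : X -> Y)
         (rep : Y -> X),
    [/\ cancel rep cls, {morph cls : x y / star x y >-> (x `&` y)%O} &
        forall x y, cls x = cls y <-> star^~ x =1 star^~ y].
Proof.
move=> starxx starA starAC.
pose S := {g : X -> X | `[< exists y, g = star^~ y >]}.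
have ex_rep (a : S) : {y | val a = star^~ y}.
  by apply: cid; apply/asboolP; exact: valP a.
pose rep a := sval (ex_rep a).
have repE a : val a = star^~ (rep a) := svalP (ex_rep a).
have cls_subproof y : `[< exists y', star^~ y = star^~ y' >].
  by apply/asboolP; exists y.
pose cls y : S := exist _ (star^~ y) (cls_subproof y).
have repK : cancel rep cls by move=> a; apply: val_inj; exact: esym (repE a).
have clsP x y : cls x = cls y <-> star^~ x =1 star^~ y.
  split=> [xy z|xy]; first exact: (congr1 (fun a : S => val a z) xy).
  by apply: val_inj; apply: funext.
pose meet a b := cls (star (rep a) (rep b)).
have cls_meet : {morph cls : x y / star x y >-> meet x y}.
  move=> x y; apply/clsP => z.
  have repcls u v : star v (rep (cls u)) = star v u.
    by have /clsP := repK (cls u); apply.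
  by rewrite /= !starA !repcls.
have meetC : commutative meet.
  move=> a b; rewrite -(repK a) -(repK b) -!cls_meet; apply/clsP => z.
  by rewrite /= !starA starAC.
have meetA : associative meet.
  by move=> a b c; rewrite -(repK a) -(repK b) -(repK c) -!cls_meet starA.
have meetxx a : meet a a = a by rewrite -(repK a) -cls_meet starxx.
pose le a b := `[< meet a b = a >].
have le_refl : reflexive le by move=> a; apply/asboolP.
have le_anti : antisymmetric le.
  by move=> a b /andP[/asboolP ab /asboolP ba]; rewrite -ab meetC.
have le_trans : transitive le.
  move=> b a c /asboolP ab /asboolP bc; apply/asboolP.
  by rewrite -ab -meetA bc.
pose C : choiceType := HB.pack S (gen_eqMixin S) (gen_choiceMixin S).
pose d := Order.Disp tt tt.
pose P : porderType d := HB.pack S (Choice.on C)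
  (Order.Le_isPOrder.Build d C le_refl le_anti le_trans).
have leEmeet (a b : P) : (a <= b)%O = ((meet a b : P) == a).
  by apply/asboolP/eqP.
pose Y : meetSemilatticeType d := HB.pack S (Order.POrder.on P)
  (Order.POrder_Meet_isSemilattice.Build d P meetC meetA leEmeet).
by exists d, Y, cls, rep.
Qed.

Section MeetGreatestLowerBound.
Variables (d : Order.disp_t) (Y : meetSemilatticeType d) (n : nat) (n_gt0 : 0 < n).

Lemma le_nary_meet (c : Y) (a : n.-tuple Y) :
  (c <= nary_meet n_gt0 a)%O <-> (forall i, c <= tnth a i)%O.
Proof.
split=> [le_c i|le_c]; first exact: le_trans le_c (nary_meet_le _ _ _).
rewrite /nary_meet /nary_ext.
have: (c <= tnth a (Ordinal n_gt0))%O by [].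
have: all (fun b => (c <= b)%O) (behead a).
  apply/allP => b /mem_behead /tnthP[i ->]; exact: le_c.
elim: (behead a) (tnth a _) => //= b s IHs y /andP[le_cb le_cs] le_cy.
by apply: IHs; rewrite // lexI le_cy.
Qed.

Lemma nary_meet_const (c : Y) (a : n.-tuple Y) :
  (forall i, tnth a i = c) -> nary_meet n_gt0 a = c.
Proof.
move=> aE; apply: le_anti; rewrite -{1}(aE (Ordinal n_gt0)) nary_meet_le /=.
by apply/le_nary_meet => i; rewrite aE.
Qed.
End MeetGreatestLowerBound.

(** * From a symmetric band to a strong semilattice of groups *)

Section Decomposition.
Variables (X : choiceType) (x0 : X) (m : nat) (F : nary_op m.+2 X).
Hypothesis F_band : symmetric_nary_band F.
Variable n_gt0 : 0 < m.+2.
Notation starF := (star x0 F).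

Variables (d : Order.disp_t) (Y : meetSemilatticeType d).
Variables (cls : X -> Y) (rep : Y -> X).
Hypotheses (repK : cancel rep cls)
  (cls_star : {morph cls : x y / starF x y >-> (x `&` y)%O})
  (cls_eq : forall x y, cls x = cls y <-> starF^~ x =1 starF^~ y).

Lemma star_cls z x y : cls x = cls y -> starF z x = starF z y.
Proof. by move/cls_eq; apply. Qed.

(** A class is determined by its translation, and the translations by [F t] and
    by [t_0 . t_1 . ... . t_(n-1)] agree; the class of the latter is a meet. *)
Lemma cls_op (t : m.+2.-tuple X) (a : m.+2.-tuple Y) :
  (forall i, cls (tnth t i) = tnth a i) -> cls (F t) = nary_meet n_gt0 a.
Proof.
move=> clst; have {clst} -> : a = [tuple of map cls t].
  by apply: eq_from_tnth => i; rewrite tnth_map clst.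
case: (tupleP t) => x s; rewrite /nary_meet /nary_ext [behead _]/=.
have -> : tnth [tuple of map cls [tuple of x :: s]] (Ordinal n_gt0) = cls x.
  by rewrite tnth_map.
have -> : foldl Order.meet (cls x) (map cls s) = cls (foldl starF x s).
  by elim: (tval s) x => //= y r IHr x; rewrite -cls_star IHr.
apply/cls_eq => z; rewrite -(seq_opE x0) star_opr ?size_tuple //=.
elim: (tval s) x => //= y r IHr x.
by rewrite -starA // IHr.
Qed.

Definition fiber (a : Y) : set X := [set x | cls x = a]%classic.

Lemma clsE a (x : fiber a) : cls (val x) = a.
Proof. by case: x => x /= /set_mem. Qed.

Lemma fiber_closed a (t : m.+2.-tuple (fiber a)) :
  F [tuple val (tnth t i) | i < m.+2] \in fiber a.
Proof.
apply/mem_set; rewrite /fiber /=.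
rewrite (@cls_op _ [tuple a | _ < m.+2]) => [|i].
  by apply: nary_meet_const => i; rewrite tnth_mktuple.
by rewrite !tnth_mktuple clsE.
Qed.

Definition fiber_op a : nary_op m.+2 (fiber a) :=
  fun t => exist (fun y => y \in fiber a) _ (fiber_closed t).

Lemma fiber_hom_subproof a b (le_ba : (b <= a)%O) (x : fiber a) :
  starF (val x) (rep b) \in fiber b.
Proof. by apply/mem_set; rewrite /fiber /= cls_star clsE repK; apply/meet_idPr. Qed.

(** The choice of [rep b] is immaterial, because elements of the same class have
    the same translation; so these maps compose. *)
Definition fiber_hom a b (le_ba : (b <= a)%O) (x : fiber a) : fiber b :=
  exist (fun y => y \in fiber b) _ (fiber_hom_subproof le_ba x).

Lemma star_tuple (t : m.+2.-tuple X) y :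
  starF (F t) y = F [tuple starF (tnth t i) y | i < m.+2].
Proof.
rewrite -(seq_opE x0) star_op ?size_tuple //.
rewrite -[map _ t]/(tval [tuple of map (starF^~ y) t]) seq_opE; congr F.
by apply: eq_from_tnth => i; rewrite tnth_map tnth_mktuple.
Qed.

Lemma fiber_strong_system : strong_system n_gt0 F fiber_op fiber_hom.
Proof.
split=> [a b le_ba t|a x|a b c le_ba le_cb x|a x].
- apply: val_inj; rewrite /= star_tuple; congr F; apply: eq_from_tnth => i.
  by rewrite !tnth_mktuple.
- apply: val_inj; rewrite /= -{2}(starxx x0 F_band (val x)).
  by apply: star_cls; rewrite repK clsE.
- apply: val_inj; rewrite /= -starA //; apply: star_cls.
  by rewrite cls_star !repK; apply/meet_idPr.
- rewrite /=; set t := [tuple val (x i) | i < m.+2].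
  pose y := [tuple fiber_hom (nary_meet_le n_gt0 a i) (x i) | i < m.+2].
  have -> : [tuple val (tnth y i) | i < m.+2] =
      [tuple starF (tnth t i) (rep (nary_meet n_gt0 a)) | i < m.+2].
    by apply: eq_from_tnth => i; rewrite !tnth_mktuple.
  rewrite -star_tuple -{1}(starxx x0 F_band (F t)); apply: star_cls.
  by rewrite repK; apply: cls_op => i; rewrite tnth_mktuple clsE.
Qed.

Lemma fiber_associative a : nary_associative (@fiber_op a).
Proof.
move=> x i lt_i; apply: val_inj => /=.
have insertE k : [tuple val (tnth (insert_at (@fiber_op a) k x) j) | j < m.+2]
    = insert_at F k (val \o x).
  apply: eq_from_tnth => j; rewrite !tnth_mktuple; do 2!case: ifP => //= _.
  by congr F; apply: eq_from_tnth => l; rewrite !tnth_mktuple.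
by rewrite !insertE; case: F_band => F_assoc _ _; apply: F_assoc.
Qed.

Lemma fiber_band a : symmetric_nary_band (@fiber_op a).
Proof.
have [_ F_sym F_idem] := F_band.
split=> [|s t|x]; first exact: fiber_associative.
  apply: val_inj; rewrite /= -[RHS](F_sym s); congr F; apply: eq_from_tnth => i.
  by rewrite !tnth_mktuple.
apply: val_inj; rewrite /= -[RHS]F_idem; congr F; apply: eq_from_tnth => i.
by rewrite !tnth_mktuple.
Qed.

Lemma fiber_star a (e x y : fiber a) : star e (@fiber_op a) x y = x.
Proof.
apply: val_inj; rewrite -[RHS](starxx x0 F_band) -(@star_cls _ (val y)) ?clsE //.
rewrite /= /star /seq_op; congr F; apply: eq_from_tnth => i; rewrite !tnth_mktuple.
case: i => -[|i] //= lt_i; case: i lt_i => [|i] //= lt_i.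
by rewrite !nth_nseq (_ : i < m).
Qed.

Lemma fiber_group a : is_abelian_group_ext n_gt0 (@fiber_op a).
Proof.
have mem_rep : rep a \in fiber a by apply/mem_set; apply: repK.
pose e : fiber a := exist (fun y => y \in fiber a) _ mem_rep.
exact: (@neutral_band_group _ e _ _ (@fiber_band a) (@fiber_star a e)).
Qed.

Lemma fiber_decomposition : strong_nary_semilattice_of n_gt0 F fiber_op.
Proof.
split; last by exists fiber_hom; apply: fiber_strong_system.
split=> [a||a b _ _ [x [<- <-]]|a x clsx|a t|a] //.
- by exists (rep a); apply: repK.
- by apply/seteqP; split=> x // _; exists (cls x).
- exact: cls_op.
- exact: fiber_associative.
Qed.
End Decomposition.

(** * From a strong semilattice of groups to a symmetric band *)

Section GroupExtension.
Variables (X : Type) (n : nat) (n_gt0 : 0 < n) (F : nary_op n X).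
Hypothesis F_group : is_abelian_group_ext n_gt0 F.

Lemma nary_ext_sum (G : zmodType) (t : n.-tuple G) :
  nary_ext n_gt0 (@GRing.add G) t = (\sum_(i < n) tnth t i)%R.
Proof.
have foldlE s y : foldl (@GRing.add G) y s = (y + \sum_(z <- s) z)%R.
  elim: s y => [|z s IHs] y /=; first by rewrite big_nil GRing.addr0.
  by rewrite IHs big_cons GRing.addrA.
rewrite -(big_tuple _ _ t xpredT id) /nary_ext foldlE -(big_cons _ _ _ _ xpredT id).
by case: t => -[|y s] sz; [case: (n) n_gt0 sz | rewrite (tnth_nth y)].
Qed.

Lemma group_ext_sum : exists cG : GRing.Zmodule X,
  let G : zmodType := GRing.Zmodule.Pack cG in
  (forall t : n.-tuple G, F t = (\sum_(i < n) tnth t i)%R) /\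
  (forall x : G, x *+ n = x)%R.
Proof.
have [cG [FE expG]] := F_group; exists cG => G; split=> [t|x].
  rewrite FE; exact: (nary_ext_sum (G := G)).
by rewrite -(prednK n_gt0) GRing.mulrS expG GRing.addr0.
Qed.

Lemma group_ext_symmetric : nary_symmetric F.
Proof.
have [cG [FE _]] := group_ext_sum => s t.
rewrite (FE [tuple tnth t (s i) | i < n]) (FE t) [RHS](reindex_inj (@perm_inj _ s)).
by apply: eq_bigr => i _; rewrite tnth_mktuple.
Qed.

Lemma group_ext_idempotent : nary_idempotent F.
Proof.
have [cG [FE mulnE]] := group_ext_sum; set G := GRing.Zmodule.Pack cG in FE mulnE.
have F_const (x : G) : F [tuple x | _ < n] = x.
  rewrite FE (eq_bigr (fun=> x)) => [|i _]; last by rewrite tnth_mktuple.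
  by rewrite GRing.sumr_const card_ord mulnE.
exact: F_const.
Qed.
End GroupExtension.

Section Composition.
Variables (n : nat) (n_gt0 : 0 < n) (X : Type) (F : nary_op n X).
Variables (d : Order.disp_t) (Y : meetSemilatticeType d).
Variables (X_ : Y -> set X) (F_ : forall a : Y, nary_op n (X_ a)).
Variable phi : forall a b : Y, (b <= a)%O -> X_ a -> X_ b.
Arguments phi {a b}.
Hypotheses (dec : nary_semilattice_of n_gt0 F F_)
  (sys : strong_system n_gt0 F F_ (@phi)).
Hypothesis group : forall a, is_abelian_group_ext n_gt0 (@F_ a).

Lemma ex_cls x : {a | X_ a x}.
Proof.
apply: cid; have [a _ Xax] : (\bigcup_a X_ a)%classic x.
  by rewrite (component_cover dec).
by exists a.
Qed.

Definition cls_of x : Y := sval (ex_cls x).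
Definition elt_of a x (Xax : X_ a x) : X_ a :=
  exist (fun y => y \in X_ a) x (mem_set Xax).

Lemma cls_ofP x : X_ (cls_of x) x. Proof. exact: svalP (ex_cls x). Qed.

Lemma cls_of_eq a x : X_ a x -> cls_of x = a.
Proof.
move=> Xax; apply: (component_disjoint dec) => //.
by exists x; split=> //; apply: cls_ofP.
Qed.

(** A total version of the structural homomorphism from the component of [x]:
    the value when [c] is not below that component is arbitrary.  Totality
    lets [proj c] be mapped over tuples and over the infinite sequences of the
    associative law. *)
Definition proj c x : X_ c :=
  if pselect (c <= cls_of x)%O is left le_c then phi le_c (elt_of (cls_ofP x))
  else elt_of (svalP (cid (component_nonempty dec c))).

Lemma projE c a (x : X_ a) (le_ca : (c <= a)%O) : proj c (val x) = phi le_ca x.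
Proof.
have Xax : X_ a (val x) := set_mem (valP x).
have {2}-> : x = elt_of Xax by apply: val_inj.
move: (val x) Xax => {}x Xax; have cls_x := cls_of_eq Xax.
case: _ / cls_x le_ca Xax => le_ca Xax.
rewrite /proj; case: pselect => [le_c|/(_ le_ca)//].
by rewrite (bool_irrelevance le_c le_ca); congr phi; apply: val_inj.
Qed.

Lemma proj_cls x : val (proj (cls_of x) x) = x.
Proof.
have := projE (elt_of (cls_ofP x)) (lexx _) => /= ->.
by rewrite (strong_id sys).
Qed.

(** Equality of the classes is tested through their lower bounds, as this is how
    meets of many elements are compared; the image of an element in its own
    component is the element itself. *)
Lemma eq_proj x y : (forall c, (c <= cls_of x)%O <-> (c <= cls_of y)%O) ->
  (forall c, (c <= cls_of x)%O -> proj c x = proj c y) -> x = y.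
Proof.
move=> eq_le eq_p; have eq_cls : cls_of x = cls_of y.
  by apply: le_anti; rewrite (eq_le _).1 //= (eq_le _).2.
by rewrite -(proj_cls x) eq_p // eq_cls proj_cls.
Qed.

Lemma cls_of_op t :
  cls_of (F t) = nary_meet n_gt0 [tuple cls_of (tnth t i) | i < n].
Proof.
by apply/cls_of_eq/(component_meet dec) => i; rewrite tnth_mktuple; apply: cls_ofP.
Qed.

Lemma le_cls_op c t :
  (c <= cls_of (F t))%O <-> forall i, (c <= cls_of (tnth t i))%O.
Proof.
rewrite cls_of_op le_nary_meet.
by split=> le_c i; have := le_c i; rewrite tnth_mktuple.
Qed.

(** The strong law writes [F t] as a product in the component of the meet, and
    the homomorphism from there to [c] composes with those coming from the
    components of the arguments. *)
Lemma proj_op c t : (c <= cls_of (F t))%O ->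
  proj c (F t) = F_ [tuple proj c (tnth t i) | i < n].
Proof.
rewrite cls_of_op; set a := [tuple _ | i < n] => le_c.
have Xa i : X_ (tnth a i) (tnth t i) by rewrite tnth_mktuple; apply: cls_ofP.
have -> : F t = F [tuple val (elt_of (Xa i)) | i < n].
  by congr F; apply: eq_from_tnth => i; rewrite tnth_mktuple.
rewrite (strong_op sys) (projE _ le_c) (strong_hom sys).
congr F_; apply: eq_from_tnth => i; rewrite !tnth_mktuple.
rewrite [LHS](strong_comp sys (nary_meet_le n_gt0 a i) le_c (elt_of (Xa i))).
by rewrite -projE.
Qed.

Lemma strong_symmetric : nary_symmetric F.
Proof.
move=> s t; apply: eq_proj => [c|c le_c].
  rewrite !le_cls_op; split=> le_c i; last by rewrite tnth_mktuple.
  by have := le_c ((s^-1)%g i); rewrite tnth_mktuple permKV.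
have le_c' : (c <= cls_of (F t))%O.
  apply/le_cls_op => i; move/le_cls_op: le_c => /(_ ((s^-1)%g i)).
  by rewrite tnth_mktuple permKV.
rewrite !proj_op // -[RHS](group_ext_symmetric (group c) s); congr F_.
by apply: eq_from_tnth => i; rewrite !tnth_mktuple.
Qed.

Lemma strong_idempotent : nary_idempotent F.
Proof.
move=> x; apply: eq_proj => [c|c le_c].
  rewrite le_cls_op; split=> [/(_ (Ordinal n_gt0))|le_c i]; by rewrite tnth_mktuple.
rewrite proj_op // -[RHS](group_ext_idempotent (group c)); congr F_.
by apply: eq_from_tnth => i; rewrite !tnth_mktuple.
Qed.

(** Both sides of the associative law involve the same first [2 n - 1] terms of
    [x], so their classes have the same lower bounds. *)
Lemma le_cls_insert c i x : i < n ->
  (c <= cls_of (F (insert_at F i x)))%O <->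
  forall j, j < n + n.-1 -> (c <= cls_of (x j))%O.
Proof.
move=> lt_i; rewrite le_cls_op; split=> le_c j.
  move=> lt_j; have [lt_ji|le_ij] := ltnP j i.
    have := le_c (Ordinal (ltn_trans lt_ji lt_i)).
    by rewrite tnth_mktuple /= lt_ji.
  have [lt_jin|le_inj] := ltnP j (i + n).
    have lt_k : j - i < n by lia.
    have := le_c (Ordinal lt_i); rewrite tnth_mktuple /= ltnn eqxx.
    by move/le_cls_op/(_ (Ordinal lt_k)); rewrite tnth_mktuple /= subnKC.
  have lt_k : j - n.-1 < n by lia.
  have := le_c (Ordinal lt_k); rewrite tnth_mktuple /=.
  by rewrite ltnNge gtn_eqF ?subnK //=; first case: leqP => //=; lia.
rewrite tnth_mktuple; case: ltnP => [lt_ji|le_ij].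
  by apply: le_c; have := ltn_ord j; lia.
case: eqP => [_|_]; last by apply: le_c; have := ltn_ord j; lia.
apply/le_cls_op => k; rewrite tnth_mktuple; apply: le_c.
by have := ltn_ord k; lia.
Qed.

Lemma proj_insert c i x : (c <= cls_of (F (insert_at F i x)))%O ->
  proj c (F (insert_at F i x)) = F_ (insert_at (@F_ c) i (proj c \o x)).
Proof.
move=> le_c; rewrite proj_op //; congr F_; apply: eq_from_tnth => j.
have := le_c; rewrite le_cls_op => /(_ j).
rewrite !tnth_mktuple; do 2!case: ifP => //= _; move=> le_cF.
rewrite proj_op //; congr F_; apply: eq_from_tnth => k.
by rewrite !tnth_mktuple.
Qed.

Lemma strong_associative : nary_associative F.
Proof.
move=> x i lt_i; have le_insert c : (c <= cls_of (F (insert_at F i x)))%O <->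
    (c <= cls_of (F (insert_at F i.+1 x)))%O.
  by rewrite !le_cls_insert // ltnW.
apply: eq_proj => // c le_c; rewrite !proj_insert //; last exact/le_insert.
exact: (component_assoc dec).
Qed.
End Composition.

Theorem theorem4p10 (X : Type) (X_nonempty : inhabited X)
    (n : nat) (n_ge2 : 2 <= n) (F : nary_op n X) :
  symmetric_nary_band F <->
  exists (d : Order.disp_t) (Y : meetSemilatticeType d)
         (X_ : Y -> set X) (F_ : forall a : Y, nary_op n (X_ a)),
    strong_nary_semilattice_of (ltnW n_ge2) F F_ /\
    (forall a : Y, is_abelian_group_ext (ltnW n_ge2) (F_ a)).
Proof.
split=> [F_band|[d [Y [X_ [F_ [[dec [phi sys]] group]]]]]]; last first.
  split; first exact: strong_associative dec sys.
    exact: strong_symmetric dec sys group.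
  exact: strong_idempotent dec sys group.
case: n n_ge2 F F_band => [|[|m]] // n_ge2 F F_band.
case: X_nonempty => x0; pose C : choiceType := {classic X}.
have [d [Y [cls [rep [repK cls_star cls_eq]]]]] := left_normal_band_semilattice
  (@starxx C x0 m F F_band) (@starA C x0 m F F_band) (@starAC C x0 m F F_band).
exists d, Y, (fiber cls),
  (@fiber_op C x0 m F F_band (ltnW n_ge2) d Y cls cls_star cls_eq).
split=> [|a]; first exact: (fiber_decomposition _ _ repK).
exact: (fiber_group _ _ repK).
Qed.
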